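(* Suppose there exists a positive integer $n$ with $\sigma(n) > H_n + \exp(H_n)\log(H_n)$. Then the smallest positive integer $m$ satisfying $\sigma(m) > H_m + \exp(H_m)\log(H_m)$ is a superabundant number.
   Context: For a positive integer $n$, $H_n=\sum_{j=1}^n \frac{1}{j}$ is the $n$th harmonic number and $\sigma(n)=\sum_{d\mid n} d$ is the sum of the divisors of $n$. A positive integer $n$ is called superabundant if $\frac{\sigma(m)}{m}<\frac{\sigma(n)}{n}$ for every positive integer $m<n$. (The inequality $\sigma(n)\le H_n+\exp(H_n)\log(H_n)$ for all $n\ge 1$ is the Lagarias inequality; a counterexample is an $n$ violating it.) *)

(* Defs.v *)
From mathcomp Require Import all_boot all_order all_algebra.
From mathcomp Require Import all_classical all_reals all_analysis.

Set Implicit Arguments.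
Unset Strict Implicit.
Unset Printing Implicit Defensive.

Import Order.TTheory GRing.Theory Num.Theory.

Local Open Scope ring_scope.

Definition harmonic_number (R : realType) (n : nat) : R :=
  \sum_(1 <= j < n.+1) j%:R^-1.

Definition sigma (n : nat) : nat := (\sum_(d <- divisors n) d)%N.

Definition abundancy (n : nat) : rat := (sigma n)%:R / n%:R.

Definition superabundant (n : nat) : Prop :=
  (0 < n)%N /\
  forall m : nat, (0 < m)%N -> (m < n)%N -> abundancy m < abundancy n.

Definition lagarias_bound (R : realType) (n : nat) : R :=
  harmonic_number R n + expR (harmonic_number R n) * ln (harmonic_number R n).

Definition lagarias_counterexample (R : realType) (n : nat) : bool :=
  (0 < n)%N && (lagarias_bound R n < (sigma n)%:R).

(* Main.v *)
Require Import Defs.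
From mathcomp Require Import all_boot all_order all_algebra.
From mathcomp Require Import all_classical all_reals all_analysis.
From mathcomp Require Import ring lra.

(** A minimal counterexample [n] satisfies [sigma m / m <= B m / m] for [m < n],
    where [B] is the Lagarias bound, while [B n / n < sigma n / n]; so it is
    enough that [B n / n] is nondecreasing.  With [a = H_n], [N = n + 1] and
    [h = 1 / N], the estimates [exp a >= N], [exp h >= 1 + h + h^2/2],
    [ln a <= a - 1] and [ln (a + h) - ln a >= h / (a + h)] reduce this to
    [(a + h) ((1 + h)/2 (a - 1) + a - 1 + h) <= N - h], a polynomial
    inequality that holds because [H_n^2] grows more slowly than [n]. *)

Set Implicit Arguments.
Unset Strict Implicit.
Unset Printing Implicit Defensive.

Import Order.TTheory GRing.Theory Num.Theory.

Local Open Scope ring_scope.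

Section RealEstimates.
Variable R : realType.
Implicit Types (x a h : R) (m n : nat).

(** For [x >= 0] the partial sums of the exponential series increase to [expR x]. *)
Lemma expR_ge1Dx_sqr x : 0 <= x -> 1 + x + x ^+ 2 / 2 <= expR x.
Proof.
move=> x0; have -> : 1 + x + x ^+ 2 / 2 = series (exp_coeff x) 3.
  rewrite /series /= !big_nat_recr //= big_geq // /exp_coeff /=.
  by rewrite !factS fact0 /=; field.
apply: nondecreasing_cvgn_le; last exact: is_cvg_series_exp_coeff.
by apply/nondecreasing_seqP => n; rewrite seriesSr lerDl exp_coeff_ge0.
Qed.

Lemma ln_le_sub1 x : 0 < x -> ln x <= x - 1.
Proof.
by move=> x0; have := @le_ln1Dx R (x - 1); rewrite subrKC; apply; lra.
Qed.

(** This is [ln y <= y - 1] at [y = a / (a + h)]. *)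
Lemma ln_increment_ge a h : 0 < a -> 0 <= h -> ln a + h / (a + h) <= ln (a + h).
Proof.
move=> a0 h0; have ah0 : 0 < a + h by lra.
have := ln_le_sub1 (divr_gt0 a0 ah0); rewrite ln_div ?posrE //.
have -> : a / (a + h) - 1 = - (h / (a + h)) by field; rewrite gt_eqF.
lra.
Qed.

Lemma harmonic_number0 : harmonic_number R 0 = 0.
Proof. by rewrite /harmonic_number big_geq. Qed.

Lemma harmonic_numberS n :
  harmonic_number R n.+1 = harmonic_number R n + n.+1%:R^-1.
Proof. by rewrite /harmonic_number big_nat_recr. Qed.

Lemma harmonic_number_ge1 n : (0 < n)%N -> 1 <= harmonic_number R n.
Proof.
case: n => // n _; elim: n => [|n IHn]; first by rewrite harmonic_numberS harmonic_number0 add0r invr1.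
by rewrite harmonic_numberS (le_trans IHn) // lerDl invr_ge0.
Qed.

(** Each factor [expR (1/k)] is at least [(k + 1) / k], and the product telescopes. *)
Lemma expR_harmonic_ge n : n.+1%:R <= expR (harmonic_number R n).
Proof.
elim: n => [|n IHn]; first by rewrite harmonic_number0 expR0.
rewrite harmonic_numberS expRD.
have -> : n.+2%:R = n.+1%:R * (1 + n.+1%:R^-1) :> R.
  by rewrite mulrDr mulr1 divff // -natr1.
by apply: ler_pM => //; rewrite ?expR_ge1Dx // addr_ge0.
Qed.

(* The linear bound makes the quadratic one inductive; [n = 6] is the first index
   from which both propagate. *)
Lemma harmonic_number_growth n :
  let H := harmonic_number R (n + 6) in
  [/\ 2 <= H, H <= 3 / 10 * (n + 6)%:R + 7 / 10
    & H * (H - 1) <= 3 / 5 * (n + 6)%:R].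
Proof.
elim: n => [|n]; first by rewrite !harmonic_numberS harmonic_number0; split; lra.
rewrite addSn harmonic_numberS /=; set H := harmonic_number R _.
move=> [H2 Hlin Hsqr].
have nE : (n + 6).+1%:R = (n + 6)%:R + 1 :> R by rewrite natr1.
have n6 : 6 <= (n + 6)%:R :> R by rewrite ler_nat leq_addl.
rewrite nE; move: ((n + 6)%:R) n6 Hlin Hsqr {nE} => x x6 Hlin Hsqr.
set h := (x + 1)^-1; have xh : (x + 1) * h = 1 by rewrite divff // gt_eqF //; lra.
have h0 : 0 < h by rewrite invr_gt0; lra.
have h7 : h <= 1 / 7 by nra.
split; [lra | lra |].
(* The left side is the increment of [H * (H - 1)], the right side is [3 / 5]; the linear bound
   compares them. *)
have step : h * (2 * H + h - 1) <= h * (3 / 5 * (x + 1)).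
  by rewrite ler_pM2l //; lra.
by nra.
Qed.

Lemma harmonic_polynomial_bound n : (0 < n)%N ->
  let a := harmonic_number R n in let h := n.+1%:R^-1 in
  (a + h) * ((1 + h) / 2 * (a - 1) + (a - 1 + h)) <= n.+1%:R - h.
Proof.
case: n => // -[|[|[|[|n]]]] _ /=;
  [by rewrite !harmonic_numberS harmonic_number0; lra..|].
have [] := harmonic_number_growth n; rewrite addnC.
rewrite -[(6 + n)%N]/n.+2.+4 [harmonic_number R n.+2.+4]harmonic_numberS.
move: (harmonic_number R n.+1.+4) => a.
have : 6 <= n.+2.+4%:R :> R by rewrite ler_nat.
move: (n.+2.+4%:R) => N N6; have N0 : N != 0 by rewrite gt_eqF //; lra.
have := divff N0; have : 0 < N^-1 by rewrite invr_gt0; lra.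
move: N^-1 => h h0 Nh b2 _ bsqr.
(* With [b = a + h] the left side is [(3 + h)/2 * b * (b - 1) - h * (1 + h)/2 * b], at most
   [9/10 * N + 3/10 - h]. *)
have hb : h * 2 <= h * (a + h) by rewrite ler_pM2l.
have : (3 + h) * ((a + h) * (a + h - 1)) <= (3 + h) * (3 / 5 * N).
  by rewrite ler_pM2l //; lra.
have h2b : 0 <= h * h * (a + h) by rewrite !mulr_ge0 //; lra.
nra.
Qed.

Lemma lagarias_bound_ratio_leS n : (0 < n)%N ->
  lagarias_bound R n / n%:R <= lagarias_bound R n.+1 / n.+1%:R.
Proof.
move=> n0; have nR0 : 0 < n%:R :> R by rewrite ltr0n.
rewrite ler_pdivrMr // mulrAC ler_pdivlMr // /lagarias_bound harmonic_numberS.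
have := harmonic_polynomial_bound n0; have := expR_harmonic_ge n.
have := harmonic_number_ge1 n0; rewrite expRD /=.
move: (harmonic_number R n) => a a1.
have -> : n%:R = n.+1%:R - 1 :> R by rewrite -natr1 addrK.
have : 2 <= n.+1%:R :> R by rewrite ler_nat ltnS.
move: (n.+1%:R) => N N2 EN; have N0 : N != 0 by rewrite gt_eqF //; lra.
have := divff N0; have : 0 < N^-1 by rewrite invr_gt0; lra.
move: N^-1 => h h0 Nh poly; have ah0 : 0 < a + h by lra.
have hE : 1 <= expR a * h by rewrite -Nh ler_pM2r.
have L0 := ln_ge0 a1; have La := @ln_le_sub1 a ltac:(lra).
have Lh := @ln_increment_ge a h ltac:(lra) (ltW h0).
have eh := expR_ge1Dx_sqr (ltW h0); have E0 := expR_gt0 a.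
move: (expR a) (expR h) (ln a) (ln (a + h)) E0 hE L0 La Lh eh {EN}.
move=> E e L L' E0 hE L0 La Lh eh.
(* Since [N * h = 1], the quadratic bound on [e] gives exactly this left side. *)
have c1 : N - h * (1 + h) / 2 <= (N - 1) * e.
  apply: le_trans (_ : (N - 1) * (1 + h + h ^+ 2 / 2) <= _); first by nra.
  by rewrite ler_pM2l //; lra.
have h1 : h <= 1 / 2 by nra.
have c2 : N - h <= (N - 1) * e by nra.
(* The gain from the logarithm's increment is at least [h * r]; it must cover the loss
   [h * (1 + h) / 2 * L] and still leave [h * (a - 1 + h)]. *)
set r := (N - h) / (a + h).
have rge : (1 + h) / 2 * (a - 1) + (a - 1 + h) <= r.
  by rewrite ler_pdivlMr // mulrC.
have ce0 : 0 <= (N - 1) * e by lra.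
have s1 : (N - 1) * e * (L + h / (a + h)) <= (N - 1) * e * L'.
  exact: ler_wpM2l.
have s2 : (N - h * (1 + h) / 2) * L <= (N - 1) * e * L by exact: ler_wpM2r.
have s3 : h * r <= (N - 1) * e * (h / (a + h)).
  rewrite /r mulrCA; apply: ler_wpM2r => //.
  by rewrite divr_ge0 // ltW.
have s4 : h * ((1 + h) / 2 * (a - 1) + (a - 1 + h)) <= h * r.
  by rewrite ler_pM2l.
have s5 : h * (1 + h) / 2 * L <= h * (1 + h) / 2 * (a - 1).
  by apply: ler_wpM2l => //; nra.
(* The cross-multiplied goal amounts to [a - 1 + h <= E * ((N - 1) * e * L' - N * L)]; the factor
   [h] is absorbed by [1 <= E * h]. *)
have bracket : h * (a - 1 + h) <= (N - 1) * e * L' - N * L by lra.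
have : E * (h * (a - 1 + h)) <= E * ((N - 1) * e * L' - N * L).
  by rewrite ler_pM2l.
have : 1 * (a - 1 + h) <= E * h * (a - 1 + h) by apply: ler_wpM2r => //; lra.
by nra.
Qed.

Lemma lagarias_bound_ratio_homo m n : (0 < m)%N -> (m <= n)%N ->
  lagarias_bound R m / m%:R <= lagarias_bound R n / n%:R.
Proof.
move=> m0; elim: n => [|n IHn]; first by case: m m0.
rewrite leq_eqVlt => /predU1P[->//|]; rewrite ltnS => mn.
exact: le_trans (IHn mn) (lagarias_bound_ratio_leS (leq_trans m0 mn)).
Qed.

End RealEstimates.

Theorem theorem3p1 (R : realType)
    (exists_counterexample : exists n : nat, lagarias_counterexample R n) :
  superabundant (ex_minn exists_counterexample).
Proof.
case: ex_minnP => n /andP[n0 Bn] n_min; split=> // m m0 mn.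
have Bm : (sigma m)%:R <= lagarias_bound R m.
  rewrite leNgt; apply/negP => Bm.
  by have := n_min m; rewrite /lagarias_counterexample m0 Bm leqNgt mn => /(_ isT).
(* The rational comparison is moved into [R], where the Lagarias bound lives. *)
rewrite -(ltr_rat R) /abundancy !rmorphM /= !fmorphV /= !ratr_nat.
apply: le_lt_trans (_ : lagarias_bound R m / m%:R < _).
  by rewrite ler_pM2r // invr_gt0 ltr0n.
apply: le_lt_trans (lagarias_bound_ratio_homo R m0 (ltnW mn)) _.
by rewrite ltr_pM2r // invr_gt0 ltr0n.
Qed.
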